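(* For any subspaces $V,W\subset X$, with the full Grassmannians of oriented subspaces $\tilde{G}(V)$ and $\tilde{G}(W)$ regarded as subsets of the unit sphere $S(\Lambda X)$ with distance given by the Euclidean angle, the directed Hausdorff distance from $\tilde{G}(V)$ to $\tilde{G}(W)$ is $h(\tilde{G}(V),\tilde{G}(W))=\Theta_{V,W}$.
   Context: $X$ is an $n$-dimensional vector space over $\mathbb{R}$ (real case) or $\mathbb{C}$ (complex case) with an inner product $\langle\cdot,\cdot\rangle$ (Hermitian in the complex case, conjugate-linear in the left entry). Subspaces and dimensions are over the same field. Principal angles: for nonzero subspaces $V,W\subset X$, with $p=\dim V$, $q=\dim W$, $m=\min\{p,q\}$, there are orthonormal bases $(e_1,\dots,e_p)$ of $V$ and $(f_1,\dots,f_q)$ of $W$ and uniquely determined numbers $0\le\theta_1\le\dots\le\theta_m\le\frac{\pi}{2}$ (the principal angles) such that $\langle e_i,f_j\rangle=\delta_{ij}\cos\theta_i$ (equal to $0$ whenever $i\neq j$). Grassmann angle: for nonzero subspaces $V,W\subset X$ with principal angles $\theta_1,\dots,\theta_m$, the Grassmann angle $\Theta_{V,W}\in[0,\frac{\pi}{2}]$ of $V$ with $W$ is $\Theta_{V,W}=\arccos(\cos\theta_1\cdots\cos\theta_m)$ if $\dim V\le\dim W$, and $\Theta_{V,W}=\frac{\pi}{2}$ if $\dim V>\dim W$. Also $\Theta_{\{0\},\{0\}}=\Theta_{\{0\},V}=0$ and $\Theta_{V,\{0\}}=\frac{\pi}{2}$ for $V\ne\{0\}$. Grassmann algebra: $\Lambda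 X=\bigoplus_p\Lambda^pX$ has the inner product determined by $\langle v_1\wedge\dots\wedge v_p,w_1\wedge\dots\wedge w_p\rangle=\det(\langle v_i,w_j\rangle)$, with distinct $\Lambda^pX$'s orthogonal, and $\langle\nu,\omega\rangle=\bar\nu\omega$ for scalars $\nu,\omega\in\Lambda^0X$. A $p$-blade is a simple multivector $v_1\wedge\dots\wedge v_p$; nonzero scalars are $0$-blades, representing $\{0\}$. An orientation of a $p$-dimensional subspace $U$ is a unit element of $\Lambda^pU$. $\tilde{G}(V)$ is the set of all oriented subspaces of $V$ (of all dimensions $0,\dots,\dim V$); identifying each oriented subspace with the unit blade orienting it, $\tilde{G}(V)=\{\text{unit blades in }\Lambda V\}\subset S(\Lambda X)$, where $S(\Lambda X)$ is the unit sphere of $\Lambda X$, with distance $d(\nu,\omega)=\theta_{\nu,\omega}=\arccos(\operatorname{Re}\langle\nu,\omega\rangle)\in[0,\pi]$. For non-empty compact sets $S,T$ in a metric space $(M,d)$, the directed Hausdorff distance from $S$ to $T$ is $h(S,T)=\max_{s\in S}d(s,T)$, where $d(s,T)=\min_{t\in T}d(s,t)$. *)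

(* Defs.v *)
From HB Require Import structures.
From mathcomp Require Import all_boot all_order all_algebra.
From mathcomp Require Import complex.
From mathcomp Require Import all_classical all_reals all_analysis.

Set Implicit Arguments.
Unset Strict Implicit.
Unset Printing Implicit Defensive.

Import Order.TTheory GRing.Theory Num.Theory.

Local Open Scope classical_set_scope.
Local Open Scope ring_scope.

Variant scalar_kind := RealScalars | ComplexScalars.

Definition base_field (R : realType) (k : scalar_kind) : numFieldType :=
  match k with RealScalars => R | ComplexScalars => (R[i])%C end.

Definition sconj (R : realType) (k : scalar_kind) :
    {rmorphism base_field R k -> base_field R k} :=
  match k with RealScalars => idfun | ComplexScalars => @conjc R end.
Arguments sconj {R k}.

Definition sRe (R : realType) (k : scalar_kind) : base_field R k -> R :=
  match k with RealScalars => id | ComplexScalars => @complex.Re R end.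
Arguments sRe {R k}.

Definition sreal (R : realType) (k : scalar_kind) : R -> base_field R k :=
  match k with RealScalars => id | ComplexScalars => real_complex R end.
Arguments sreal {R k}.

(* Library forms are linear on the left and conjugate-linear on the right; the *)
(* convention here is the opposite one, hence the swap.                        *)
Definition inner (R : realType) (k : scalar_kind) (X : vectType (base_field R k))
    (dot : {dot X for sconj}) (u v : X) : base_field R k :=
  dot v u.

Definition is_principal_angles (R : realType) (k : scalar_kind)
    (X : vectType (base_field R k)) (dot : {dot X for sconj})
    (V W : {vspace X}) (th : seq R) : Prop :=
  [/\ size th = minn (\dim V) (\dim W),
      sorted <=%R th,
      all (fun t => 0 <= t <= pi / 2) th
    & exists e f : seq X,
      [/\ basis_of V e /\ orthonormal dot e,
          basis_of W f /\ orthonormal dot f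
        & forall i j, (i < \dim V)%N -> (j < \dim W)%N ->
            inner dot e`_i f`_j = if i == j then sreal (cos th`_i) else 0]].

(* The default value [::] is never used when V and W are nonzero: principal    *)
(* angles always exist, and are unique.                                        *)
Definition principal_angles (R : realType) (k : scalar_kind)
    (X : vectType (base_field R k)) (dot : {dot X for sconj})
    (V W : {vspace X}) : seq R :=
  xget [::] [set th : seq R | is_principal_angles dot V W th].

Definition Grassmann_angle (R : realType) (k : scalar_kind)
    (X : vectType (base_field R k)) (dot : {dot X for sconj})
    (V W : {vspace X}) : R :=
  if V == 0%VS then 0
  else if W == 0%VS then pi / 2
  else if (\dim V <= \dim W)%N then
    acos (\prod_(t <- principal_angles dot V W) cos t)
  else pi / 2.

(* The Grassmann algebra of X: with b_0, ..., b_(n-1) the basis                *)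
(* vbasis {:X}, a multivector is given by its coordinates in the basis         *)
(* b_S = b_(i_1) /\ ... /\ b_(i_p), where S = {i_1 < ... < i_p} ranges over    *)
(* the subsets of {0, ..., n-1}.                                               *)

Definition multivector (R : realType) (k : scalar_kind)
    (X : vectType (base_field R k)) : Type :=
  {ffun {set 'I_(\dim {:X})} -> base_field R k}.

Definition mv_scalar (R : realType) (k : scalar_kind)
    (X : vectType (base_field R k)) (c : base_field R k) : multivector X :=
  [ffun S => if S == finset.set0 then c else 0].
Arguments mv_scalar {R k} X c.

Definition mv_vector (R : realType) (k : scalar_kind)
    (X : vectType (base_field R k)) (v : X) : multivector X :=
  [ffun S => \sum_(i | S == [set i]%SET) coord (vbasis {:X}) i v].

Definition inversions (n : nat) (S T : {set 'I_n}) : nat :=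
  #|[set ij in finset.setX S T | (ij.2 < ij.1)%N]%SET|.

(* The bilinear product with b_S /\ b_T = (-1)^(inversions S T) b_(S u T) when *)
(* S and T are disjoint, and b_S /\ b_T = 0 otherwise.                         *)
Definition wedge (R : realType) (k : scalar_kind)
    (X : vectType (base_field R k)) (nu om : multivector X) : multivector X :=
  [ffun U : {set 'I_(\dim {:X})} =>
    \sum_(S : {set 'I_(\dim {:X})} | S \subset U)
      (-1) ^+ inversions S (U :\: S)%SET * (nu S * om (U :\: S)%SET)].

Definition wedges (R : realType) (k : scalar_kind)
    (X : vectType (base_field R k)) (s : seq X) : multivector X :=
  \big[@wedge R k X/mv_scalar X 1]_(v <- s) mv_vector v.

Definition gram_det (R : realType) (k : scalar_kind)
    (X : vectType (base_field R k)) (dot : {dot X for sconj})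
    (v w : seq X) : base_field R k :=
  if size v == size w then
    \det (\matrix_(i < size v, j < size v) inner dot v`_i w`_j)
  else 0.

Definition basis_vectors (R : realType) (k : scalar_kind)
    (X : vectType (base_field R k)) (S : {set 'I_(\dim {:X})}) : seq X :=
  [seq (vbasis {:X})`_i | i : 'I_(\dim {:X}) <- enum S].

(* The form determined by <v_1 /\ ... /\ v_p, w_1 /\ ... /\ w_q> =              *)
(* gram_det v w, obtained as the sesquilinear extension of its values on the   *)
(* pairs b_S, b_T.                                                             *)
Definition mv_inner (R : realType) (k : scalar_kind)
    (X : vectType (base_field R k)) (dot : {dot X for sconj})
    (nu om : multivector X) : base_field R k :=
  \sum_S \sum_T sconj (nu S) * om T *
    gram_det dot (basis_vectors S) (basis_vectors T).

Definition is_blade_of (R : realType) (k : scalar_kind)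
    (X : vectType (base_field R k)) (V : {vspace X}) (om : multivector X) : Prop :=
  (exists2 c : base_field R k, c != 0 & om = mv_scalar X c) \/
  (exists s : seq X,
     [/\ (0 < size s)%N, {subset s <= V} & om = wedges s]).

Definition unit_sphere (R : realType) (k : scalar_kind)
    (X : vectType (base_field R k)) (dot : {dot X for sconj}) :
    set (multivector X) :=
  [set om | mv_inner dot om om = 1].

Definition sphere_dist (R : realType) (k : scalar_kind)
    (X : vectType (base_field R k)) (dot : {dot X for sconj})
    (nu om : multivector X) : R :=
  acos (sRe (mv_inner dot nu om)).

(* An oriented subspace U of V is identified with the unit blade orienting it. *)
Definition oriented_Grassmannian (R : realType) (k : scalar_kind)
    (X : vectType (base_field R k)) (dot : {dot X for sconj}) (V : {vspace X}) :
    set (multivector X) :=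
  [set om | is_blade_of V om] `&` unit_sphere dot.

Definition is_minimum (R : realType) (A : set R) (m : R) : Prop :=
  A m /\ lbound A m.

Definition is_maximum (R : realType) (A : set R) (m : R) : Prop :=
  A m /\ ubound A m.

(* h = max_(s in S) delta s, with delta s = min_(t in T) d s t; both extrema   *)
(* are required to be attained.                                                *)
Definition is_directed_Hausdorff (R : realType) (M : Type) (d : M -> M -> R)
    (S T : set M) (h : R) : Prop :=
  exists delta : M -> R,
    (forall s, S s -> is_minimum [set d s t | t in T] (delta s)) /\
    is_maximum [set delta s | s in S] h.

(* Main.v *)
Require Import Defs.
From HB Require Import structures.
From mathcomp Require Import all_boot all_order all_algebra.
From mathcomp Require Import perm complex.
From mathcomp Require Import all_classical all_reals all_analysis.
From mathcomp Require Import ring lra.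

(** A unit blade of positive degree p in V is v = v_1 /\ ... /\ v_p with Gram
    determinant 1, and the inner product of two blades is a Gram determinant
    ([mv_inner_wedges]), so distances between oriented subspaces are questions
    about determinants.

    Let P be the orthogonal projection onto W and Pv = P v_1 /\ ... /\ P v_p.
    For a blade w of W, <v, w> = <Pv, w>; by Cauchy-Schwarz the largest value
    of Re <v, w> over the unit blades w of W is therefore |Pv|. It is attained
    at Pv / |Pv| if Pv does not vanish; otherwise it is 0 and is attained at a
    unit scalar, because distinct degrees are orthogonal. So the distance from
    v to the unit blades of W is acos |Pv| ([blade_dist_min]), while a unit
    scalar lies in both Grassmannians and has distance 0.

    It remains to minimise |Pv| over V. If dim V > dim W, the projection of the
    blade of an orthonormal basis of V has more factors than the dimension of
    W, so it vanishes and the maximal distance is pi / 2. If dim V <= dim W,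
    take principal bases e of V and f of W, with cosines c. Then
    P e_i = c_i f_i, hence P e_S = (prod_(i in S) c_i) f_S for the blades e_S of
    subsets of e, and expanding v in the orthonormal family of the e_S gives
    |Pv|^2 = sum_S |v_S|^2 prod_(i in S) c_i^2 >= (prod_i c_i)^2
    ([proj_gram_ge]), with equality when v is the blade of all of e
    ([proj_gram_principal]).

    The coordinates v_S are minors, and both the expansion above and the passage
    from the inner product in coordinates to Gram determinants are instances of
    the Cauchy-Binet formula ([Cauchy_Binet]).

    Principal bases exist ([exists_principal_angles]) by induction: a
    singular pair of the matrix of inner products, found from an eigenvector of
    a positive semidefinite matrix ([singular_pair]), gives one vector of each
    basis, and the construction goes on in the orthogonal complements. *)

Set Implicit Arguments.
Unset Strict Implicit.
Unset Printing Implicit Defensive.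

Import Order.TTheory GRing.Theory Num.Theory.

Local Open Scope ring_scope.

(** * Minors and the Cauchy-Binet formula *)

Section Minors.
Variable K : comNzRingType.

(** The columns in S are read off the increasing enumeration of S as a list with
    default 0, which avoids transporting along #|S| = p; the value is the usual
    minor when #|S| = p. Rows are indexed by nat so that families of vectors
    given as lists can be used directly. *)
Definition minor (n p : nat) (A : nat -> 'I_n -> K) (S : {set 'I_n}) : K :=
  \det (\matrix_(i < p, j < p) [seq A i k | k <- enum S]`_j).

(** An injection of 'I_p onto a set S of size p is a permutation followed by a
    fixed enumeration h of S; this reindexes the part of a sum over maps
    that has image S. *)
Lemma sum_inj_image (n p : nat) (S : {set 'I_n}) (F : {ffun 'I_p -> 'I_n} -> K)
    (h : 'I_p -> 'I_n) :
  #|S| = p -> injective h -> (forall i, h i \in S) ->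
  \sum_(f : {ffun 'I_p -> 'I_n} | injectiveb f && ((f @: predT)%SET == S)) F f
  = \sum_(s : 'S_p) F [ffun i => h (s i)].
Proof.
move=> cardS h_inj hS.
have u_inj : injective (fun s : 'S_p => [ffun i => h (s i)] : {ffun 'I_p -> 'I_n}).
  by move=> s t /ffunP e; apply/permP=> i; have := e i; rewrite !ffunE => /h_inj.
rewrite -(big_imset (h := fun s : 'S_p => [ffun i => h (s i)]) _ (in2W u_inj)).
apply: eq_bigl => f; apply/idP/idP; last first.
  case/imsetP=> s _ ->; apply/andP; split.
    by apply/injectiveP=> i j; rewrite !ffunE => /h_inj /perm_inj.
  rewrite eqEcard cardS; apply/andP; split.
    by apply/fintype.subsetP=> _ /imsetP [i _ ->]; rewrite ffunE.
  by rewrite card_imset ?card_ord // => i j; rewrite !ffunE => /h_inj /perm_inj.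
case/andP => f_inj fS.
(* the inclusion is clear, and both sets have p! elements *)
suff -> : ((fun s : 'S_p => [ffun i => h (s i)]) @: predT)%SET
   = [set f : {ffun 'I_p -> 'I_n} in ffun_on S | injectiveb f]%SET.
  rewrite inE f_inj andbT; apply/ffun_onP => i.
  by rewrite -(eqP fS) imset_f.
apply/eqP; rewrite eqEcard; apply/andP; split.
  apply/fintype.subsetP=> _ /imsetP [s _ ->]; rewrite inE; apply/andP; split.
    by apply/ffun_onP=> i; rewrite ffunE.
  by apply/injectiveP=> i j; rewrite !ffunE => /h_inj /perm_inj.
by rewrite card_inj_ffuns_on card_imset // card_Sn cardS card_ord ffactnn.
Qed.

(** Expanding each entry by multilinearity gives a sum over all maps f from rows
    to columns; a map that is not injective contributes a determinant with two
    equal columns. Grouping the injective maps by their image S, the sum over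
    the remaining permutation is the product of the two minors on S. *)
Lemma Cauchy_Binet (n p : nat) (A B : nat -> 'I_n -> K) :
  \det (\matrix_(i < p, j < p) \sum_k A i k * B j k) =
  \sum_(S : {set 'I_n} | #|S| == p) minor p A S * minor p B S.
Proof.
(* the contribution of a map f that chooses a column for each row *)
pose G (f : {ffun 'I_p -> 'I_n}) :=
  (\prod_(i < p) A i (f i)) * \det (\matrix_(i < p, j < p) B j (f i)).
have -> : \det (\matrix_(i < p, j < p) \sum_k A i k * B j k) = \sum_f G f.
  rewrite /determinant.
  under eq_bigr => s _.
    under eq_bigr => i _ do rewrite mxE.
    rewrite bigA_distr_bigA /= mulr_sumr.
    over.
  rewrite exchange_big /=; apply: eq_bigr => f _.
  rewrite /G /determinant mulr_sumr; apply: eq_bigr => s _.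
  rewrite big_split /= mulrCA; congr (_ * (_ * _)).
  by apply: eq_bigr => i _; rewrite mxE.
have G0 (f : {ffun 'I_p -> 'I_n}) : ~~ injectiveb f -> G f = 0.
  case/injectivePn => i [j ij fij]; rewrite /G.
  by rewrite (determinant_alternate ij) ?mulr0 // => l; rewrite !mxE fij.
rewrite (bigID (fun f : {ffun 'I_p -> 'I_n} => injectiveb f)) /= [X in _ + X]big1 //= addr0.
rewrite (partition_big (fun f : {ffun 'I_p -> 'I_n} => (f @: predT)%SET)
   (fun S : {set 'I_n} => #|S| == p)) /=; last first.
  by move=> f /injectiveP f_inj; rewrite card_imset // card_ord.
apply: eq_bigr => S /eqP cardS.
pose h (i : 'I_p) := enum_val (cast_ord (esym cardS) i).
have hS i : h i \in S by exact: enum_valP.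
have h_inj : injective h.
  move=> i j e; apply: (@cast_ord_inj _ _ (esym cardS)); apply: enum_val_inj; exact: e.
rewrite (@sum_inj_image _ _ S G h) //.
have nthh (C : nat -> 'I_n -> K) i (j : 'I_p) : [seq C i k | k <- enum S]`_j = C i (h j).
  have jS : (j < size (enum S))%N by rewrite -cardE cardS.
  by rewrite (nth_map (h j)) //; congr (C i _); rewrite [RHS](enum_val_nth (h j)).
have -> : minor p B S = \det (\matrix_(i < p, j < p) B j (h i)).
  rewrite /minor -det_tr; congr (\det _); apply/matrixP=> i j.
  by rewrite !mxE nthh.
rewrite /minor [X in X * _]/determinant mulr_suml; apply: eq_bigr => s _.
rewrite /G -mulrA mulrCA; congr (_ * _).
  by apply: eq_bigr => i _; rewrite ffunE mxE nthh.
rewrite -det_perm -det_mulmx -row_permE; congr (\det _).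
by apply/matrixP=> i j; rewrite !mxE ffunE.
Qed.

Lemma minor_scale n p (a : nat -> 'I_n -> K) (c : 'I_n -> K)
    (S : {set 'I_n}) : #|S| = p ->
  minor p (fun i l => a i l * c l) S = minor p a S * \prod_(l in S) c l.
Proof.
move=> cardS; have size_enum : size (enum S) = p by rewrite -cardE.
pose d : 'rV[K]_p := \row_j [seq c l | l <- enum S]`_j.
have -> : \prod_(l in S) c l = \det (diag_mx d).
  rewrite det_diag -big_enum /= -(big_map c predT id) (big_nth 0) size_map size_enum.
  by rewrite big_mkord; apply: eq_bigr => j _; rewrite mxE.
rewrite /minor -det_mulmx mul_mx_diag; congr (\det _); apply/matrixP=> i j.
have jS : (j < size (enum S))%N by rewrite size_enum.
have k0 : 'I_n by case: (enum S) jS => // l.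
by rewrite !mxE !(nth_map k0).
Qed.

End Minors.

Lemma rmorph_minor (K K' : comNzRingType) (f : {rmorphism K -> K'}) n p
    (a : nat -> 'I_n -> K) (S : {set 'I_n}) :
  f (minor p a S) = minor p (fun i j => f (a i j)) S.
Proof.
rewrite /minor -det_map_mx; congr (\det _); apply/matrixP=> i j; rewrite !mxE.
rewrite (map_comp f (a i)); have [js|js] := ltnP j (size [seq a i l | l <- enum S]).
  by rewrite (nth_map 0).
by rewrite !nth_default ?rmorph0 // size_map.
Qed.

(** * Coordinates of blades *)

Section Wedge.

(** Positions in the enumeration of a set of ordinals can then be counted as
    numbers of smaller elements, which is what inversions do. *)
Lemma sorted_enum_ord (n : nat) (S : {set 'I_n}) : sorted ltn [seq val k | k <- enum S].
Proof.
rewrite -[enum _](eq_filter (mem_enum _)).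
rewrite -(eq_filter (mem_map val_inj _)) -filter_map.
by rewrite (sorted_filter ltn_trans) // unlock val_ord_enum iota_ltn_sorted.
Qed.

Lemma enum_setD1 (T : finType) (S : {set T}) (x : T) :
  enum (S :\ x)%SET = rem x (enum S).
Proof.
rewrite rem_filter ?enum_uniq // {1}/enum_mem -filter_predI.
by apply: eq_filter => y; rewrite !inE.
Qed.

(** This makes the sign in the product of b_k with b_(S minus k), where k is the
    i-th element of S, the one that column i gets in the expansion of a
    determinant along its first row. *)
Lemma inversions_set1 (n : nat) (S : {set 'I_n}) (i : nat) (k0 : 'I_n) :
  (i < #|S|)%N -> inversions [set nth k0 (enum S) i] (S :\ nth k0 (enum S) i)%SET = i.
Proof.
rewrite cardE => iS; set k := nth _ _ _; rewrite /inversions.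
have -> : [set ij in finset.setX [set k] (S :\ k) | (ij.2 < ij.1)%N]%SET
   = [set (k, j) | j in [set j in S | (j < k)%N]]%SET.
  apply/setP => -[a b]; rewrite !inE /=; apply/idP/imsetP.
    by case/andP=> /andP[/eqP -> /andP[_ bS]] bk; exists b; rewrite // inE bS.
  case=> j; rewrite inE => /andP[jS jk] [-> ->]; rewrite eqxx jS jk !andbT /=.
  by apply: contraTneq jk => ->; rewrite ltnn.
rewrite card_imset => [|a b []//].
have -> : #|[set j in S | (j < k)%N]%SET| = count (fun j : 'I_n => (j < k)%N) (enum S).
  rewrite cardE -size_filter {1}/enum_mem; congr size.
  rewrite -filter_predI; apply: eq_filter => j /=.
  by rewrite !inE andbC.
rewrite -(count_map val (fun j : nat => (j < k)%N)).
have /= := @count_lt_nth _ nat 0%N [seq val k | k <- enum S] i (sorted_enum_ord S).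
by rewrite size_map => /(_ iS) e; rewrite -[RHS]e (nth_map k0).
Qed.

Variables (R : realType) (k : scalar_kind) (X : vectType (base_field R k)).
Notation F := (base_field R k).
Notation n := (\dim {:X}).

Lemma mv_vector_wedge (v : X) (om : multivector X) (U : {set 'I_n}) :
  wedge (mv_vector v) om U =
  \sum_(i in U) (-1) ^+ inversions [set i] (U :\ i)%SET *
     (coord (vbasis {:X}) i v * om (U :\ i)%SET).
Proof.
rewrite ffunE.
rewrite (bigID (fun S : {set 'I_n} => S \in [set [set i] | i in U]%SET)) /=.
rewrite [X in _ + X]big1 ?addr0; last first.
  move=> S /andP[SU /negP nS]; rewrite ffunE big1 ?mul0r ?mulr0 // => i /eqP Si.
  by case: nS; rewrite Si imset_f // -finset.sub1set -Si.
transitivity (\sum_(S in [set [set i] | i in U]%SET)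
   (-1) ^+ inversions S (U :\: S)%SET * (mv_vector v S * om (U :\: S)%SET)).
  apply: eq_bigl => S; rewrite andb_idl // => /imsetP[i iU ->].
  by rewrite finset.sub1set.
rewrite big_imset /=; last by move=> i j _ _ /set1_inj.
apply: eq_bigr => i iU; congr (_ * (_ * _)).
rewrite ffunE (eq_bigl (pred1 i)) ?big_pred1_eq // => j.
by rewrite /= eq_sym (inj_eq set1_inj).
Qed.

(** By induction on the number of factors: the product with one more vector is
    the Laplace expansion of the minor along its first row. *)
Lemma wedges_coef (s : seq X) (S : {set 'I_n}) :
  wedges s S = if #|S| == size s
    then minor (size s) (fun i j => coord (vbasis {:X}) j s`_i) S else 0.
Proof.
elim: s S => [|v s IHs] S.
  rewrite /wedges big_nil ffunE cards_eq0 /minor /=; case: eqP => // _.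
  by rewrite det_mx00.
rewrite /wedges big_cons mv_vector_wedge -/(wedges s).
case: eqP => [cardS|cardS]; last first.
  rewrite big1 // => i iS; rewrite IHs; case: eqP; rewrite ?mulr0 // => e.
  by case: cardS; rewrite (cardsD1 i) iS e.
rewrite /= in cardS *.
have size_enum : size (enum S) = (size s).+1 by rewrite -cardE.
have k0 : 'I_n by case: (enum S) size_enum => // a.
rewrite /minor (expand_det_row _ 0).
rewrite -big_enum /= (big_nth k0) size_enum big_mkord; apply: eq_bigr => j _.
have jS : (j < #|S|)%N by rewrite cardS.
have jS' : (j < size (enum S))%N by rewrite -cardE.
rewrite inversions_set1 // mulrCA mxE (nth_map k0) //; congr (_ * _).
have jjS : nth k0 (enum S) j \in S by rewrite -mem_enum mem_nth.
rewrite IHs (_ : #|(S :\ _)%SET| == _) /cofactor; last first.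
  by move: (cardS); rewrite (cardsD1 (nth k0 (enum S) j)) jjS add1n => -[->].
rewrite add0n; congr (_ * \det _); apply/matrixP=> a b; rewrite !mxE /=.
(* deleting the j-th element from the enumeration of S shifts the later ones
   exactly as lift j does with column indices *)
rewrite enum_setD1 remE index_uniq ?enum_uniq //.
have bs : (b < size s)%N := ltn_ord b.
rewrite (nth_map k0); last first.
  by rewrite size_cat size_takel ?(ltnW jS') // size_drop size_enum subSS subnKC // -ltnS.
rewrite (nth_map k0); last by rewrite size_enum; exact: (ltn_ord (lift j b)).
rewrite add0n; congr (coord _ _ _).
rewrite nth_cat size_takel ?(ltnW jS') //= /bump; case: ltnP => bj.
  by rewrite nth_take // leqNgt bj.
by rewrite nth_drop addSn subnKC.
Qed.

End Wedge.

(** * The inner product of blades *)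

Section MvInner.
Variables (R : realType) (k : scalar_kind) (X : vectType (base_field R k)).
Variable dot : {dot X for @sconj R k}.
Notation F := (base_field R k).
Notation n := (\dim {:X}).
Notation inner := (@inner R k X dot).

Lemma innerZr u (a : F) v : inner u (a *: v) = a * inner u v.
Proof. by rewrite /Defs.inner linearZl_LR. Qed.

Lemma inner_sumr I (r : seq I) (P : pred I) u (E : I -> X) :
  inner u (\sum_(i <- r | P i) E i) = \sum_(i <- r | P i) inner u (E i).
Proof. by rewrite /Defs.inner linear_sumlz. Qed.

Lemma innerZl v (a : F) u : inner (a *: u) v = sconj a * inner u v.
Proof. by rewrite /Defs.inner linearZr_LR. Qed.

Lemma inner_suml I (r : seq I) (P : pred I) v (E : I -> X) :
  inner (\sum_(i <- r | P i) E i) v = \sum_(i <- r | P i) inner (E i) v.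
Proof. by rewrite /Defs.inner linear_sumr. Qed.

Lemma innerC u v : inner v u = sconj (inner u v).
Proof. by rewrite /Defs.inner hermC expr0 mul1r. Qed.

Lemma size_basis_vectors (S : {set 'I_n}) : size (basis_vectors S) = #|S|.
Proof. by rewrite size_map -cardE. Qed.

Lemma nth_basis_vectors (S : {set 'I_n}) (f : X -> F) i : (i < #|S|)%N ->
  [seq f (vbasis {:X})`_j | j : 'I_n <- enum S]`_i = f (basis_vectors S)`_i.
Proof.
move=> iS; have jS : (i < size (enum S))%N by rewrite -cardE.
have k0 : 'I_n by case: (enum S) jS => // a.
by rewrite (nth_map k0) // (nth_map k0).
Qed.

(** The two sums over basis blades are two applications of the Cauchy-Binet
    formula, because the Gram determinant of basis vectors of S and T is itself
    a minor of the Gram matrix of the basis. *)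
Lemma mv_inner_wedges (v w : seq X) :
  mv_inner dot (wedges v) (wedges w) = gram_det dot v w.
Proof.
rewrite /mv_inner.
pose c (s : seq X) (i : nat) (j : 'I_n) : F := coord (vbasis {:X}) j s`_i.
have sumE (s : seq X) i : s`_i = \sum_j c s i j *: (vbasis {:X})`_j.
  by apply: coord_vbasis; exact: memvf.
have [svw|svw] := eqVneq (size v) (size w); last first.
  rewrite /gram_det (negbTE svw) big1 // => S _; rewrite big1 // => T _.
  rewrite !wedges_coef !size_basis_vectors.
  case: eqP => [->|]; last by rewrite rmorph0 !mul0r.
  case: eqP => [->|]; last by rewrite mulr0 mul0r.
  by rewrite (negbTE svw) mulr0.
set p := size v.
(* summing over T first contracts w with the rows in S of the Gram matrix *)
have sumT (S : {set 'I_n}) : #|S| = p -> \sum_(T : {set 'I_n} | #|T| == p)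
    minor p (c w) T * gram_det dot (basis_vectors S) (basis_vectors T)
  = minor p (fun j (l : 'I_n) => inner (vbasis {:X})`_l w`_j) S.
  move=> cardS; transitivity (\det (\matrix_(i < p, j < p)
     \sum_(l < n) inner (basis_vectors S)`_i (vbasis {:X})`_l * c w j l)).
    rewrite (@Cauchy_Binet _ n p
      (fun i (l : 'I_n) => inner (basis_vectors S)`_i (vbasis {:X})`_l)).
    apply: eq_bigr => T /eqP cardT; rewrite mulrC; congr (_ * _).
    rewrite /gram_det !size_basis_vectors cardS cardT eqxx /minor.
    by congr (\det _); apply/matrixP=> i j; rewrite !mxE nth_basis_vectors ?cardT.
  rewrite /minor -det_tr; congr (\det _); apply/matrixP=> i j; rewrite !mxE.
  rewrite (nth_basis_vectors (fun u => inner u w`_i)) ?cardS // [w`_i]sumE inner_sumr.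
  by apply: eq_bigr => l _; rewrite innerZr mulrC.
transitivity (\sum_(S : {set 'I_n} | #|S| == p)
   minor p (fun i (l : 'I_n) => sconj (c v i l)) S *
   minor p (fun j (l : 'I_n) => inner (vbasis {:X})`_l w`_j) S).
  rewrite [RHS]big_mkcond; apply: eq_bigr => S _.
  case: ifPn => [/eqP cardS|cardS]; last first.
    by rewrite big1 // => T _; rewrite wedges_coef (negbTE cardS) rmorph0 !mul0r.
  rewrite -sumT // mulr_sumr [RHS]big_mkcond; apply: eq_bigr => T _.
  rewrite !wedges_coef cardS eqxx -svw -/p; case: eqP => _; last by rewrite mulr0 mul0r.
  by rewrite rmorph_minor mulrA.
rewrite -Cauchy_Binet /gram_det -svw eqxx; congr (\det _).
apply/matrixP=> i j; rewrite !mxE [v`_i]sumE inner_suml.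
by apply: eq_bigr => l _; rewrite innerZl.
Qed.

End MvInner.

(** * Real parts and moduli of scalars *)

Section Scalars.
Variables (R : realType) (k : scalar_kind).
Notation F := (base_field R k).
Implicit Types (x y : F) (r t : R).

Lemma sconjK x : sconj (sconj x) = x.
Proof. by case: k x => //= x; rewrite conjcK. Qed.

Lemma sRe0 : sRe (0 : F) = 0.
Proof. by case: k. Qed.

Lemma sReD x y : sRe (x + y) = sRe x + sRe y.
Proof. by case: k x y => //= -[a b] [c d]. Qed.

Lemma sReN x : sRe (- x) = - sRe x.
Proof. by case: k x => //= -[a b]. Qed.

Lemma sRe_sum I (s : seq I) (P : pred I) (f : I -> F) :
  sRe (\sum_(i <- s | P i) f i) = \sum_(i <- s | P i) sRe (f i).
Proof. exact: (big_morph _ sReD sRe0). Qed.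

Lemma sRe_conj x : sRe (sconj x) = sRe x.
Proof. by case: k x => //= -[a b]. Qed.

Lemma srealK r : sRe (sreal r : F) = r.
Proof. by case: k. Qed.

Lemma sconj_real r : sconj (sreal r : F) = sreal r.
Proof. by case: k => //=; exact: conjc_real. Qed.

Lemma sreal0 : sreal 0 = 0 :> F.
Proof. by case: k. Qed.

Lemma sreal1 : sreal 1 = 1 :> F.
Proof. by case: k. Qed.

Lemma srealM r t : sreal (r * t) = sreal r * sreal t :> F.
Proof. by case: k => //=; rewrite rmorphM. Qed.

Lemma sRe_mulr r x : sRe (sreal r * x) = r * sRe x.
Proof. by case: k x => //= -[a b] /=; rewrite mul0r subr0. Qed.

Lemma sreal_prod I (s : seq I) (P : pred I) (f : I -> R) :
  sreal (\prod_(i <- s | P i) f i) = \prod_(i <- s | P i) sreal (f i) :> F.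
Proof. exact: (big_morph _ srealM sreal1). Qed.

Lemma sreal_eq0 r : (sreal r == 0 :> F) = (r == 0).
Proof.
apply/eqP/eqP => [e|->]; last exact: sreal0.
by rewrite -(srealK r) e sRe0.
Qed.

Lemma sreal_gt0P x : 0 < x -> x = sreal (sRe x) /\ 0 < sRe x.
Proof. by case: k x => //= -[a b]; rewrite ltcE /= => /andP[/eqP -> ->]. Qed.

Definition normsq x : R := sRe (sconj x * x).

Lemma normsqE x : sconj x * x = sreal (normsq x).
Proof.
rewrite /normsq; case: k x => //= -[a b] /=; apply/eqP; rewrite eq_complex /=.
by rewrite eqxx /=; apply/eqP; ring.
Qed.

Lemma normsq_ge0 x : 0 <= normsq x.
Proof.
rewrite /normsq; case: k x => /= [x|[a b]] /=; first by rewrite -expr2 sqr_ge0.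
by rewrite mulNr opprK -!expr2 addr_ge0 ?sqr_ge0.
Qed.

Lemma normsq_eq0 x : (normsq x == 0) = (x == 0).
Proof.
rewrite -sreal_eq0 -normsqE mulf_eq0; apply: orb_idl.
by rewrite fmorph_eq0.
Qed.

Lemma normsqM x y : normsq (x * y) = normsq x * normsq y.
Proof.
rewrite -[LHS]srealK -normsqE rmorphM mulrACA !normsqE -srealM; exact: srealK.
Qed.

Lemma normsq_real r : normsq (sreal r : F) = r ^+ 2.
Proof. by rewrite /normsq sconj_real sRe_mulr srealK. Qed.

Lemma sRe_mulC x y : sRe (sconj x * y) = sRe (sconj y * x).
Proof. by rewrite -sRe_conj rmorphM sconjK mulrC. Qed.

(** Only the real part enters the distance, and for it a real multiple
    suffices: with l the real part of the sum, 0 <= sum |a_i - l b_i|^2 expands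
    to sum |a_i|^2 - l^2. *)
Lemma sum_CauchySchwarz (I : finType) (P : pred I) (a b : I -> F) :
  \sum_(i | P i) normsq (b i) = 1 ->
  (sRe (\sum_(i | P i) sconj (a i) * b i)) ^+ 2 <= \sum_(i | P i) normsq (a i).
Proof.
move=> b1; set l := sRe _.
have : 0 <= \sum_(i | P i) normsq (a i - sreal l * b i).
  by apply: sumr_ge0 => i _; exact: normsq_ge0.
have nE i : normsq (a i - sreal l * b i) =
    normsq (a i) - 2 * l * sRe (sconj (a i) * b i) + l ^+ 2 * normsq (b i).
  rewrite {1}/normsq rmorphB rmorphM sconj_real mulrBl !mulrBr !(sReD, sReN).
  rewrite mulrCA sRe_mulr -mulrA sRe_mulr -[sreal l * sconj _ * _]mulrA.
  rewrite [sconj (b i) * (_ * _)]mulrCA !sRe_mulr.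
  rewrite [sRe (sconj (b i) * a i)]sRe_mulC -/(normsq _) -/(normsq _); ring.
under eq_bigr => i _ do rewrite nE.
rewrite big_split /= sumrB -!mulr_sumr b1 -(sRe_sum _ P (fun i => sconj (a i) * b i)) -/l.
by move=> h; nra.
Qed.

End Scalars.

(** * Orthonormal families *)

Section Orthonormal.
Variables (R : realType) (k : scalar_kind) (X : vectType (base_field R k)).
Variable dot : {dot X for @sconj R k}.
Notation F := (base_field R k).
Notation inner := (@inner R k X dot).
Implicit Types (u v w : X) (e f : seq X) (V W : {vspace X}).

Lemma inner_gt0 u : u != 0 -> 0 < inner u u.
Proof. exact: neq0_dnorm_gt0. Qed.

Lemma orthonormalP f :
  reflect (forall i j, (i < size f)%N -> (j < size f)%N -> inner f`_i f`_j = (i == j)%:R)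
          (orthonormal dot f).
Proof.
have pairE (s : seq X) : pair_ortho_rec dot s = pairwise (fun u v => dot u v == 0) s.
  by elim: s => //= u s ->; rewrite andbT; congr (_ && _); apply: eq_all.
rewrite /orthonormal pairE; apply: (iffP andP) => [[/allP n1 /(pairwiseP 0) o2] i j hi hj|h].
  have [<-|ij] := eqVneq i j; first by apply/eqP; apply: n1; rewrite mem_nth.
  case: (ltngtP i j) ij => // ij _.
    by rewrite innerC [inner _ _](eqP (o2 _ _ hi hj ij)) rmorph0.
  exact/eqP/(o2 _ _ hj hi ij).
split.
  by apply/(all_nthP 0) => i hi /=; have := h _ _ hi hi; rewrite eqxx => /eqP.
by apply/(pairwiseP 0) => i j hi hj ij; apply/eqP; rewrite [LHS]h // gtn_eqF.
Qed.

Lemma inner_eq0C u v : inner u v = 0 -> inner v u = 0.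
Proof. by move=> uv0; rewrite innerC uv0 rmorph0. Qed.

Lemma orthonormal_coord f v : orthonormal dot f -> v \in <<f>>%VS ->
  v = \sum_(i < size f) inner f`_i v *: f`_i.
Proof.
move=> /orthonormalP fo vf; rewrite {1}(coord_span (X := in_tuple f) vf).
apply: eq_bigr => i _; congr (_ *: _).
rewrite [in RHS](coord_span (X := in_tuple f) vf) inner_sumr (bigD1 i) //=.
rewrite innerZr fo // eqxx mulr1 big1 ?addr0 // => j ji.
by rewrite innerZr fo // [_ == _](_ : _ = false) ?mulr0 // eq_sym; apply: negbTE.
Qed.

Lemma orthonormal_basis V f : orthonormal dot f -> {subset f <= V} ->
  size f = \dim V -> basis_of V f.
Proof.
move=> /orthonormalP fo fV sf; rewrite basisEfree sf leqnn andbT.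
apply/andP; split; last by apply/span_subvP.
apply/(@freeP _ _ _ (in_tuple f)) => c /= c0 i.
have := congr1 (inner f`_i) c0.
rewrite inner_sumr (bigD1 i) //= innerZr fo // eqxx mulr1 big1 ?addr0; last first.
  by move=> j ji; rewrite innerZr fo // [_ == _](_ : _ = false) ?mulr0 // eq_sym; apply: negbTE.
by move=> ->; rewrite /Defs.inner linear0l.
Qed.

Lemma normalize u : u != 0 -> exists r : R, inner (sreal r *: u) (sreal r *: u) = 1.
Proof.
move=> u0; have [e g0] := sreal_gt0P (inner_gt0 u0).
move: (sRe _) e g0 => g e g0.
exists (Num.sqrt g)^-1; rewrite innerZl innerZr sconj_real e.
rewrite -!srealM mulrA -expr2 exprVn sqr_sqrtr ?ltW // mulVf ?sreal1 //.
by rewrite gt_eqF.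
Qed.

Lemma dim_orthov1 u V : inner u u = 1 -> u \in V ->
  (\dim (V :&: orthov dot <[u]>)).+1 = \dim V.
Proof.
move=> u1 uV; rewrite -eq_dim_orthov1; last first.
  by apply/mem_orthovPn; exists u => //; rewrite [_ u u]u1 oner_eq0.
rewrite prednK // lt0n dimv_eq0; apply: contraTneq uV => ->.
rewrite memv0; apply: contra_eqN u1 => /eqP ->.
by rewrite /Defs.inner linear0l eq_sym oner_eq0.
Qed.

Lemma exists_unit V : V != 0%VS -> exists2 u, u \in V & inner u u = 1.
Proof.
move=> V0; have : vpick V != 0 by rewrite vpick0.
by case/normalize=> r r1; exists (sreal r *: vpick V) => //; rewrite memvZ ?memv_pick.
Qed.

Lemma orthonormal_cons u f : inner u u = 1 -> orthonormal dot f ->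
  {in f, forall v, inner u v = 0} -> orthonormal dot (u :: f).
Proof.
move=> u1 /orthonormalP fo uf; apply/orthonormalP => -[|i] [|j] //= hi hj.
- by rewrite uf // mem_nth.
- by apply: inner_eq0C; rewrite uf // mem_nth.
- by rewrite fo.
Qed.

Lemma mem_orthov1E u v : (v \in orthov dot <[u]>) = (inner u v == 0).
Proof. by rewrite mem_orthov1. Qed.

Lemma basis_cons_orthov u V f : inner u u = 1 -> u \in V ->
  basis_of (V :&: orthov dot <[u]>) f -> orthonormal dot f ->
  basis_of V (u :: f) /\ orthonormal dot (u :: f).
Proof.
move=> u1 uV bf fo.
have uf v : v \in f -> inner u v = 0.
  by move/(basis_mem bf); rewrite memv_cap mem_orthov1E => /andP[_ /eqP].
have fo' := orthonormal_cons u1 fo uf; split=> //.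
apply: orthonormal_basis fo' _ _; last first.
  by rewrite /= -(dim_orthov1 u1 uV) (size_basis (X := in_tuple f) bf).
move=> v; rewrite inE => /predU1P[->//|/(basis_mem bf)].
by rewrite memv_cap => /andP[].
Qed.

(** Induction on the dimension: a unit vector of V followed by an orthonormal
    basis of its orthogonal complement in V. *)
Lemma exists_orthonormal_basis V : exists f, basis_of V f /\ orthonormal dot f.
Proof.
elim: {V}(\dim V) {-2}V (erefl (\dim V)) => [|p IH] V dV.
  exists [::]; split=> //; rewrite basisEdim dV leqnn andbT.
  by move/eqP: dV; rewrite dimv_eq0 => /eqP ->; rewrite sub0v.
have V0 : V != 0%VS by rewrite -dimv_eq0 dV.
have [u uV u1] := exists_unit V0.
have [|f [bf fo]] := IH (V :&: orthov dot <[u]>)%VS.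
  by apply/eqP; rewrite -eqSS dim_orthov1 ?dV.
by exists (u :: f); exact: basis_cons_orthov.
Qed.

End Orthonormal.

(** * Singular pairs of a matrix *)

Section Singular.
Variables (R : realType).

Definition adj (k : scalar_kind) m n (M : 'M[base_field R k]_(m, n)) := map_mx sconj M^T.

Section Kind.
Variable k : scalar_kind.
Notation F := (base_field R k).

Lemma adjK m n (M : 'M[F]_(m, n)) : adj (adj M) = M.
Proof. by apply/matrixP=> i j; rewrite !mxE sconjK. Qed.

Lemma adjM m n p (A : 'M[F]_(m, n)) (B : 'M[F]_(n, p)) :
  adj (A *m B) = adj B *m adj A.
Proof. by rewrite /adj trmx_mul map_mxM. Qed.

Lemma adjZ m n (a : F) (A : 'M[F]_(m, n)) : adj (a *: A) = sconj a *: adj A.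
Proof. by apply/matrixP=> i j; rewrite !mxE rmorphM. Qed.

Definition rvnormsq n (x : 'rV[F]_n) : R := \sum_i normsq (x 0 i).

Lemma mul_adj n (x : 'rV[F]_n) : x *m adj x = (sreal (rvnormsq x))%:M.
Proof.
apply/matrixP=> i j; rewrite !ord1 !mxE mulr1n /rvnormsq.
rewrite (big_morph (fun r : R => sreal r : F) (id1 := 0) (op1 := +%R)); first last.
- exact: sreal0.
- by move=> a b; case: (k) => //=; rewrite rmorphD.
by apply: eq_bigr => l _; rewrite !mxE mulrC normsqE.
Qed.

Lemma rvnormsq_ge0 n (x : 'rV[F]_n) : 0 <= rvnormsq x.
Proof. by apply: sumr_ge0 => i _; exact: normsq_ge0. Qed.

Lemma rvnormsq_eq0 n (x : 'rV[F]_n) : (rvnormsq x == 0) = (x == 0).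
Proof.
apply/eqP/eqP => [x0|->]; last first.
  by rewrite /rvnormsq big1 // => i _; rewrite mxE; apply/eqP; rewrite normsq_eq0.
apply/rowP=> i; rewrite mxE; apply/eqP; rewrite -normsq_eq0; move/eqP: x0.
rewrite psumr_eq0 => [/allP/(_ i)|j _]; last exact: normsq_ge0.
by rewrite mem_index_enum; apply.
Qed.

(** If x M adj(M) = a x, then |x M|^2 = a |x|^2, so a is a quotient of two real
    numbers. *)
Lemma eigenvalue_gram_real p q (M : 'M[F]_(p, q)) (a : F) :
  eigenvalue (M *m adj M) a ->
  exists2 l : R, a = sreal l & exists2 x : 'rV_p, rvnormsq x != 0 &
    x *m (M *m adj M) = a *: x /\ rvnormsq (x *m M) = l * rvnormsq x.
Proof.
case/eigenvalueP=> x xa; rewrite -rvnormsq_eq0 => x0.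
have e : sreal (rvnormsq (x *m M)) = a * sreal (rvnormsq x).
  have /matrixP/(_ 0 0) : (x *m M) *m adj (x *m M) = a *: (x *m adj x).
    by rewrite adjM scalemxAl -xa !mulmxA.
  by rewrite !mul_adj !mxE !mulr1n.
exists (rvnormsq (x *m M) / rvnormsq x).
  have x1 : sreal (rvnormsq x) != 0 :> F by rewrite sreal_eq0.
  apply: (mulIf x1); rewrite -e -srealM; congr sreal.
  by rewrite divfK.
by exists x => //; split=> //; rewrite divfK.
Qed.

Lemma rv_normalize n (x : 'rV[F]_n) : rvnormsq x != 0 ->
  exists r : R, rvnormsq (sreal r *: x) = 1.
Proof.
move=> x0; have g0 : 0 < rvnormsq x by rewrite lt0r x0 rvnormsq_ge0.
exists (Num.sqrt (rvnormsq x))^-1.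
rewrite {1}/rvnormsq; under eq_bigr => i _ do rewrite mxE normsqM normsq_real.
by rewrite -mulr_sumr exprVn sqr_sqrtr ?ltW // mulVf.
Qed.

End Kind.

(** Over the complex numbers the characteristic polynomial has a root. A real
    matrix is viewed as a complex one: the eigenvalue obtained is real, and the
    characteristic polynomial is the same, so it is an eigenvalue over the reals. *)
Lemma exists_eigenvalue_gram (k : scalar_kind) p q (M : 'M[base_field R k]_(p, q)) :
  (0 < p)%N -> exists a, eigenvalue (M *m adj M) a.
Proof.
case: k M => M p0; last exact: (@eigenvalue_closed (R[i])%C _ (M *m adj M) p0).
pose MC : 'M[base_field R ComplexScalars]_(p, q) := map_mx (real_complex R) M.
have [a ea] := @eigenvalue_closed (R[i])%C _ (MC *m adj MC) p0.
have [l al _] := @eigenvalue_gram_real ComplexScalars p q MC a ea.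
exists l; rewrite eigenvalue_root_char -(fmorph_root (real_complex R)) map_char_poly.
have -> : map_mx (real_complex R) (M *m adj M) = MC *m adj MC.
  rewrite map_mxM; congr (_ *m _); apply/matrixP=> i j; rewrite !mxE.
  exact: (esym (@sconj_real R ComplexScalars (M j i))).
by move: ea; rewrite al eigenvalue_root_char.
Qed.

(** Let x be a unit eigenvector of M adj(M) with eigenvalue l >= 0. If l > 0, then
    c = sqrt l and y = x M / c form a singular pair with x. If l = 0, then
    x M = 0, so M has rank less than p <= q, and any unit vector killed by M on
    the other side can serve as y, with c = 0; this is where p <= q matters. *)
Lemma singular_pair (k : scalar_kind) p q (M : 'M[base_field R k]_(p, q)) :
  (0 < p <= q)%N ->
  exists c : R, exists x : 'rV_p, exists y : 'rV_q,
  [/\ 0 <= c, rvnormsq x = 1, rvnormsq y = 1, x *m M = sreal c *: y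
    & M *m adj y = sreal c *: adj x].
Proof.
case/andP=> p0 pq; have [a] := exists_eigenvalue_gram M p0.
case/eigenvalue_gram_real => l al [x x0 [xa xM]].
have [r r1] := rv_normalize x0; pose e := sreal r *: x.
have ea : e *m (M *m adj M) = sreal l *: e by rewrite -scalemxAl xa scalerA mulrC -scalerA -al.
have eM : rvnormsq (e *m M) = l.
  have /matrixP/(_ 0 0) : (e *m M) *m adj (e *m M) = sreal l *: (e *m adj e).
    by rewrite adjM scalemxAl -ea !mulmxA.
  rewrite !mul_adj !mxE !mulr1n r1 sreal1 mulr1 => /(congr1 sRe).
  by rewrite !srealK.
have [l0|l0] := eqVneq l 0.
  have eM0 : e *m M = 0 by apply/eqP; rewrite -rvnormsq_eq0 eM l0.
  have e0 : e != 0 by rewrite -rvnormsq_eq0 r1 oner_eq0.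
  (* a nonzero x with x M = 0 makes the rank drop below p <= q *)
  have rM : (\rank M < p)%N.
    rewrite ltn_neqAle rank_leq_row andbT; apply: contra e0 => fM.
    by rewrite -(mulmx_free_eq0 e fM) eM0.
  have : kermx M^T != 0.
    by rewrite -mxrank_eq0 mxrank_ker mxrank_tr subn_eq0 -ltnNge (leq_trans rM).
  case/rowV0Pn => z /sub_kermxP zM; rewrite -rvnormsq_eq0 => z0.
  pose y := map_mx sconj z.
  have yM : M *m adj y = 0.
    have -> : adj y = z^T by apply/matrixP=> i j; rewrite !mxE sconjK.
    by apply: trmx_inj; rewrite trmx_mul trmxK zM trmx0.
  have y0 : rvnormsq y != 0.
    rewrite rvnormsq_eq0; apply: contra z0; rewrite rvnormsq_eq0 => /eqP/rowP y0.
    by apply/eqP/rowP => i; have := y0 i; rewrite !mxE => /eqP; rewrite fmorph_eq0 => /eqP.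
  have [s s1] := rv_normalize y0.
  exists 0, e, (sreal s *: y); split=> //; first by rewrite eM0 sreal0 scale0r.
  by rewrite adjZ -scalemxAr yM sreal0 scale0r scaler0.
have lp : 0 < l by rewrite lt0r l0 -eM rvnormsq_ge0.
set c := Num.sqrt l; have cp : 0 < c by rewrite sqrtr_gt0.
have cc : c * c = l by rewrite -expr2 sqr_sqrtr ?ltW.
have c0 : c != 0 by rewrite gt_eqF.
exists c, e, (sreal c^-1 *: (e *m M)); split=> //; first exact: ltW.
- rewrite /rvnormsq; under eq_bigr => i _ do rewrite mxE normsqM normsq_real.
  by rewrite -mulr_sumr -/(rvnormsq _) eM -cc exprVn expr2 mulVf // mulf_neq0.
- by rewrite scalerA -srealM divff // sreal1 scale1r.
- rewrite adjZ sconj_real -scalemxAr adjM mulmxA.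
  have -> : M *m adj M *m adj e = sreal l *: adj e.
    by rewrite -[sreal l]sconj_real -adjZ -ea !adjM !adjK.
  by rewrite scalerA -srealM -cc mulrA mulVf // mul1r.
Qed.

End Singular.

(** * Existence of principal angles *)

Lemma le_acos (R : realType) (x y : R) : -1 <= x -> x <= y -> y <= 1 ->
  acos y <= acos x.
Proof.
move=> x1 xy y1; rewrite leNgt; apply/negP => lt_acos.
have hx : -1 <= x <= 1 by rewrite x1 (le_trans xy).
have hy : -1 <= y <= 1 by rewrite y1 (le_trans x1).
have : cos (acos y) < cos (acos x).
  by rewrite ltr_cos // in_itv /= acos_ge0 // acos_lepi.
by rewrite !acosK ?in_itv //= ltNge xy.
Qed.

Section PrincipalAngles.
Variables (R : realType) (k : scalar_kind) (X : vectType (base_field R k)).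
Variable dot : {dot X for @sconj R k}.
Notation F := (base_field R k).
Notation inner := (@inner R k X dot).
Implicit Types (u v w : X) (e f : seq X) (V W : {vspace X}).

Lemma Parseval f u v : orthonormal dot f -> v \in <<f>>%VS ->
  inner u v = \sum_(l < size f) sconj (inner f`_l u) * inner f`_l v.
Proof.
move=> fo vf; rewrite {1}(orthonormal_coord fo vf) inner_sumr.
by apply: eq_bigr => l _; rewrite innerZr mulrC -innerC.
Qed.

Lemma inner_CauchySchwarz u v : inner v v = 1 ->
  sRe (inner u v) ^+ 2 <= sRe (inner u u).
Proof.
have [f [bf fo]] := exists_orthonormal_basis dot fullv.
have inf x : x \in <<f>>%VS by rewrite (span_basis bf) memvf.
rewrite !(@Parseval f) // => /(congr1 sRe); rewrite sRe_sum -sreal1 srealK => v1.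
rewrite [leRHS]sRe_sum; exact: sum_CauchySchwarz v1.
Qed.

(** The coordinates are conjugated because the inner product is conjugate-linear
    in its left entry; pairing [vec_of f x] on the left is then linear in x. *)
Definition vec_of f n (x : 'rV[F]_n) : X := \sum_(i < n) sconj (x 0 i) *: f`_i.

Lemma inner_vec_of f n (x : 'rV[F]_n) v :
  inner (vec_of f x) v = \sum_(i < n) x 0 i * inner f`_i v.
Proof. by rewrite inner_suml; apply: eq_bigr => i _; rewrite innerZl sconjK. Qed.

Lemma vec_of_mem f V n (x : 'rV[F]_n) : {subset f <= V} -> (n <= size f)%N ->
  vec_of f x \in V.
Proof.
move=> fV nf; apply: memv_suml => i _; apply/memvZ/fV/mem_nth.
exact: leq_trans (ltn_ord i) nf.
Qed.

Lemma inner_basis_vec_of f n (x : 'rV[F]_n) (i : 'I_n) : orthonormal dot f ->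
  n = size f -> inner f`_i (vec_of f x) = sconj (x 0 i).
Proof.
move=> /orthonormalP fo nf; rewrite inner_sumr (bigD1 i) //=.
have lt_f (j : 'I_n) : (j < size f)%N by rewrite -nf.
rewrite innerZr fo // eqxx mulr1 big1 ?addr0 // => j ji.
by rewrite innerZr fo // [_ == _](_ : _ = false) ?mulr0 // eq_sym; apply: negbTE.
Qed.

Lemma inner_vec_of_unit f n (x : 'rV[F]_n) : orthonormal dot f -> n = size f ->
  rvnormsq x = 1 -> inner (vec_of f x) (vec_of f x) = 1.
Proof.
move=> fo nf x1; rewrite inner_vec_of.
under eq_bigr => i _ do rewrite inner_basis_vec_of //.
have /matrixP/(_ 0 0) := mul_adj x; rewrite x1 sreal1 !mxE mulr1n => <-.
by apply: eq_bigr => i _; rewrite !mxE.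
Qed.

(** The last two clauses say that the projection of u onto W is c v and the
    projection of v onto V is c u. In particular u is orthogonal to the
    complement of v in W, and v to the complement of u in V, so the induction
    can continue in these complements. *)
Lemma singular_vectors V W : (0 < \dim V <= \dim W)%N ->
  exists c : R, exists u v,
  [/\ 0 <= c <= 1, u \in V /\ inner u u = 1, v \in W /\ inner v v = 1,
     {in W, forall w, inner u w = sreal c * inner v w}
   & {in V, forall w, inner w v = sreal c * inner w u}].
Proof.
move=> dVW.
have [a [ba ao]] := exists_orthonormal_basis dot V.
have [b [bb bo]] := exists_orthonormal_basis dot W.
have sa : \dim V = size a by exact: (size_basis (X := in_tuple a)).
have sb : \dim W = size b by exact: (size_basis (X := in_tuple b)).
pose M : 'M[F]_(\dim V, \dim W) := \matrix_(i, j) inner a`_i b`_j.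
have [c [x [y [c0 x1 y1 xM My]]]] := singular_pair M dVW.
pose u := vec_of a x; pose v := vec_of b y.
have uV : u \in V by apply: vec_of_mem; rewrite ?sa // => z; exact: basis_mem.
have vW : v \in W by apply: vec_of_mem; rewrite ?sb // => z; exact: basis_mem.
have u1 : inner u u = 1 by exact: inner_vec_of_unit.
have v1 : inner v v = 1 by exact: inner_vec_of_unit.
have uw : {in W, forall w, inner u w = sreal c * inner v w}.
  move=> w wW; have wb : w \in <<b>>%VS by rewrite (span_basis bb).
  rewrite (orthonormal_coord bo wb) !inner_sumr mulr_sumr -sb.
  apply: eq_bigr => j _; rewrite !innerZr mulrCA; congr (_ * _).
  rewrite (innerC _ b`_j v) inner_basis_vec_of // sconjK.
  have /rowP/(_ j) := xM; rewrite !mxE => <-; rewrite inner_vec_of.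
  by apply: eq_bigr => i _; rewrite mxE.
have wv : {in V, forall w, inner w v = sreal c * inner w u}.
  move=> w wV; have wa : w \in <<a>>%VS by rewrite (span_basis ba).
  rewrite (orthonormal_coord ao wa) !inner_suml mulr_sumr -sa.
  apply: eq_bigr => j _; rewrite !innerZl mulrCA; congr (_ * _).
  rewrite inner_basis_vec_of //.
  have /colP/(_ j) := My; rewrite !mxE => <-; rewrite inner_sumr.
  by apply: eq_bigr => i _; rewrite !mxE innerZr mulrC.
exists c, u, v; split=> //; rewrite c0 /=.
(* c = <u, v> for unit vectors u and v, so c <= 1 *)
have := inner_CauchySchwarz u v1; rewrite uw // v1 mulr1 u1 srealK -sreal1 srealK.
by rewrite -[leRHS](expr1n _ 2) ler_sqr ?nnegrE.
Qed.

(** The cosines appear in the order in which singular vectors are found; they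
    are sorted afterwards. *)
Lemma unsorted_principal_vectors V W : (\dim V <= \dim W)%N ->
  exists c : seq R, exists e f,
  [/\ size c = \dim V, all (fun r : R => 0 <= r <= 1) c,
      basis_of V e /\ orthonormal dot e, basis_of W f /\ orthonormal dot f
    & forall i j, (i < \dim V)%N -> (j < \dim W)%N ->
        inner e`_i f`_j = if i == j then sreal c`_i else 0].
Proof.
elim: {V}(\dim V) {-2}V W (erefl (\dim V)) => [|p IH] V W dV dVW.
  have [e be] := exists_orthonormal_basis dot V.
  have [f bf] := exists_orthonormal_basis dot W.
  exists [::], e, f; split; rewrite ?dV //.
have [|c [u [v [c01 [uV u1] [vW v1] uw wv]]]] := @singular_vectors V W.
  by rewrite dVW dV.
have dV' := dim_orthov1 u1 uV; have dW' := dim_orthov1 v1 vW.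
have [||c' [e [f [sc c'01 [be oe] [bf of_] ef]]]] :=
    IH (V :&: orthov dot <[u]>)%VS (W :&: orthov dot <[v]>)%VS.
- by apply/eqP; rewrite -eqSS dV' dV.
- by rewrite -ltnS dV' dW'.
have se : size e = p.
  by apply/eqP; rewrite -eqSS -dV -dV' (size_basis (X := in_tuple e) be).
have sf : (size f).+1 = \dim W by rewrite -dW' (size_basis (X := in_tuple f) bf).
exists (c :: c'), (u :: e), (v :: f); split.
- by rewrite /= sc.
- by rewrite /= c01.
- exact: basis_cons_orthov.
- exact: basis_cons_orthov.
move=> [|i] [|j] /= hi hj.
- by rewrite uw // v1 mulr1.
- have /(basis_mem bf) : f`_j \in f by rewrite mem_nth // -ltnS sf.
  by rewrite memv_cap mem_orthov1E => /andP[jW /eqP vj]; rewrite uw // vj mulr0.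
- have /(basis_mem be) : e`_i \in e by rewrite mem_nth // se -ltnS -dV.
  rewrite memv_cap mem_orthov1E => /andP[iV /eqP ui].
  by rewrite wv // (inner_eq0C ui) mulr0.
- by rewrite ef // -ltnS ?dV' ?dW'.
Qed.

Lemma orthonormal_nth f (s : seq nat) : orthonormal dot f -> uniq s ->
  {in s, forall i, (i < size f)%N} -> orthonormal dot [seq f`_i | i <- s].
Proof.
move=> /orthonormalP fo us sf; apply/orthonormalP=> i j; rewrite size_map => hi hj.
by rewrite !(nth_map 0%N) // fo ?sf ?mem_nth // nth_uniq.
Qed.

(** The angles are the arccosines of the c_i; a permutation s that sorts them is
    applied to both bases. *)
Lemma exists_principal_angles V W : (\dim V <= \dim W)%N ->
  exists th, is_principal_angles dot V W th.
Proof.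
move=> dVW; have [c [e [f [sc /allP c01 [be oe] [bf of_] ef]]]] := unsorted_principal_vectors dVW.
have se : size e = \dim V by rewrite (size_basis (X := in_tuple e) be).
have sf : size f = \dim W by rewrite (size_basis (X := in_tuple f) bf).
pose th := [seq acos r | r <- c].
have sth : size th = \dim V by rewrite size_map.
pose s := sort (relpre (nth 0 th) <=%R) (iota 0 (\dim V)).
(* f is permuted by s on its first dim V entries only *)
pose t := s ++ iota (\dim V) (\dim W - \dim V).
have ss : size s = \dim V by rewrite size_sort size_iota.
have ps : perm_eq s (iota 0 (\dim V)) by rewrite perm_sort.
have pt : perm_eq t (iota 0 (\dim W)).
  by rewrite -[in X in perm_eq _ X](subnKC dVW) iotaD add0n perm_cat2r.
have pe : perm_eq [seq e`_i | i <- s] e.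
  by rewrite -{2}(mkseq_nth 0 e) /mkseq se perm_map.
have pf : perm_eq [seq f`_i | i <- t] f.
  by rewrite -{2}(mkseq_nth 0 f) /mkseq sf perm_map.
have slt i : (i < \dim V)%N -> (nth 0%N s i < \dim V)%N.
  by move=> hi; have := mem_nth 0%N (s := s) (n := i); rewrite ss (perm_mem ps) mem_iota => /(_ hi).
have tlt i : (i < \dim W)%N -> (nth 0%N t i < \dim W)%N.
  move=> hi; have := mem_nth 0%N (s := t) (n := i).
  by rewrite (perm_size pt) (perm_mem pt) mem_iota size_iota => /(_ hi).
have nth_s i : (i < \dim V)%N -> nth 0%N s i = nth 0%N t i.
  by move=> hi; rewrite nth_cat ss hi.
have cP i : (i < \dim V)%N -> 0 <= c`_i <= 1 by move=> hi; apply: c01; rewrite mem_nth ?sc.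
exists [seq th`_i | i <- s]; split.
- by rewrite size_map ss (minn_idPl dVW).
- rewrite sorted_map; apply: sort_sorted => i j; exact: le_total.
- rewrite all_map; apply/allP => i; rewrite (perm_mem ps) mem_iota /= add0n => hi.
  rewrite (nth_map 0) ?sc //; have /andP[c0 c1] := cP _ hi.
  rewrite acos_ge0 ?(le_trans _ c0) ?c1 ?lerN10 //= -acos0.
  by rewrite le_acos ?lerN10.
exists [seq e`_i | i <- s], [seq f`_i | i <- t]; split.
- rewrite (perm_basis _ pe); split=> //; apply: orthonormal_nth oe _ _;
    first by rewrite (perm_uniq ps) iota_uniq.
  by move=> i; rewrite (perm_mem ps) mem_iota se.
- rewrite (perm_basis _ pf); split=> //; apply: orthonormal_nth of_ _ _;
    first by rewrite (perm_uniq pt) iota_uniq.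
  by move=> i; rewrite (perm_mem pt) mem_iota sf.
move=> i j hi hj; rewrite (nth_map 0%N) ?ss // (nth_map 0%N) ?(perm_size pt) ?size_iota //.
rewrite ef ?slt ?tlt // nth_s // (nth_map 0%N) ?ss // -nth_s //.
rewrite (nth_map 0) ?sc ?slt // acosK; last first.
  by rewrite in_itv /=; have /andP[c0 ->] := cP _ (slt _ hi); rewrite (le_trans _ c0) ?lerN10.
rewrite nth_s // nth_uniq ?(perm_uniq pt) ?iota_uniq ?(perm_size pt) ?size_iota //.
exact: leq_trans hi dVW.
Qed.

End PrincipalAngles.

(** * Gram determinants and orthogonal projection *)

Section GramDet.
Variables (R : realType) (k : scalar_kind) (X : vectType (base_field R k)).
Variable dot : {dot X for @sconj R k}.
Notation F := (base_field R k).
Notation inner := (@inner R k X dot).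
Notation gram := (@gram_det R k X dot).
Implicit Types (u : X) (e f v w : seq X) (V W : {vspace X}).

Lemma gram_detE p v w : size v = p -> size w = p ->
  gram v w = \det (\matrix_(i < p, j < p) inner v`_i w`_j).
Proof. by move=> <- sw; rewrite /gram_det sw eqxx. Qed.

Lemma gram_det_neq_size v w : size v != size w -> gram v w = 0.
Proof. by rewrite /gram_det => /negbTE ->. Qed.

Lemma gram_detC v w : gram w v = sconj (gram v w).
Proof.
have [svw|svw] := eqVneq (size v) (size w); last first.
  by rewrite !gram_det_neq_size ?rmorph0 // eq_sym.
rewrite (gram_detE svw (erefl _)) (gram_detE (erefl _) svw) -det_map_mx -det_tr.
by congr (\det _); apply/matrixP=> i j; rewrite !mxE innerC.
Qed.

Lemma gram_det_scaler (a : F) u v w :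
  gram v (a *: u :: w) = a * gram v (u :: w).
Proof.
have [sv|sv] := eqVneq (size v) (size w).+1; last first.
  by rewrite !gram_det_neq_size ?mulr0.
rewrite !(@gram_detE (size w).+1) // -[in LHS]det_tr -[in RHS]det_tr.
set A := (X in \det X = _); set B := (X in _ = _ * \det X).
(* A is a times B in row 0, so the second term gets coefficient 0 *)
rewrite (@determinant_multilinear _ _ A B B 0 a 0) ?mul0r ?addr0 //.
- by apply/rowP=> j; rewrite !mxE /= innerZr mul0r addr0.
- by apply/matrixP=> i j; rewrite !mxE.
- by apply/matrixP=> i j; rewrite !mxE.
Qed.

Lemma gram_det_scalel (a : F) u v w :
  gram (a *: u :: w) v = sconj a * gram (u :: w) v.
Proof. by rewrite gram_detC gram_det_scaler rmorphM -gram_detC. Qed.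

(** The coefficient of f_l in v_i, when f is orthonormal and spans v_i. *)
Definition coords f v (i : nat) (l : 'I_(size f)) : F := inner f`_l v`_i.

Lemma gram_det_minors f v w p : orthonormal dot f -> {subset w <= <<f>>%VS} ->
  size v = p -> size w = p ->
  gram v w = \sum_(S : {set 'I_(size f)} | #|S| == p)
    sconj (minor p (coords v) S) * minor p (coords w) S.
Proof.
move=> fo wf sv sw; rewrite (gram_detE sv sw).
under eq_bigr => S _ do rewrite rmorph_minor.
rewrite -Cauchy_Binet; congr (\det _); apply/matrixP=> i j; rewrite !mxE.
by rewrite (Parseval _ fo) // wf // mem_nth // sw.
Qed.

Lemma gram_det_normsq f v p : orthonormal dot f -> {subset v <= <<f>>%VS} ->
  size v = p ->
  sRe (gram v v) =
  \sum_(S : {set 'I_(size f)} | #|S| == p) normsq (minor p (coords v) S).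
Proof. by move=> fo vf sv; rewrite (gram_det_minors fo vf sv sv) sRe_sum. Qed.

Lemma span_fullv_basis f : basis_of fullv f -> forall v, {subset v <= <<f>>%VS}.
Proof. by move=> bf v u _; rewrite (span_basis bf) memvf. Qed.

Lemma gram_det_ge0 v : 0 <= sRe (gram v v).
Proof.
have [f [bf fo]] := exists_orthonormal_basis dot fullv.
rewrite (gram_det_normsq fo (span_fullv_basis bf (v := v)) (erefl _)).
by apply: sumr_ge0 => S _; exact: normsq_ge0.
Qed.

(** A Hermitian matrix has a real determinant. *)
Lemma gram_det_real v : gram v v = sreal (sRe (gram v v)).
Proof.
have : sconj (gram v v) = gram v v by rewrite -gram_detC.
move: (gram v v) => x; case: k x => //= -[a b] [] /eqP.
by rewrite eq_sym -addr_eq0 -mulr2n mulrn_eq0 /= => /eqP ->.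
Qed.

(** In an orthonormal basis of the whole space, the Gram determinants are sums
    over minors, so this is the Cauchy-Schwarz inequality for finite sums. *)
Lemma gram_det_CauchySchwarz v w : gram w w = 1 ->
  sRe (gram v w) ^+ 2 <= sRe (gram v v).
Proof.
have [svw w1|svw _] := eqVneq (size v) (size w); last first.
  by rewrite gram_det_neq_size // sRe0 expr0n gram_det_ge0.
have [f [bf fo]] := exists_orthonormal_basis dot fullv.
have inf := span_fullv_basis bf.
rewrite (gram_det_normsq fo (inf v) svw) (gram_det_minors fo (inf w) svw (erefl _)).
apply: sum_CauchySchwarz; rewrite -gram_det_normsq //.
by rewrite w1 -sreal1 srealK.
Qed.

Definition proj f u : X := \sum_(i < size f) inner f`_i u *: f`_i.

Lemma proj_mem f u : proj f u \in <<f>>%VS.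
Proof. by apply: memv_suml => i _; apply/memvZ/memv_span/mem_nth. Qed.

Lemma map_proj_mem f v : {subset map (proj f) v <= <<f>>%VS}.
Proof. by move=> _ /seq.mapP [u _ ->]; exact: proj_mem. Qed.

Lemma inner_proj f u x : orthonormal dot f -> x \in <<f>>%VS ->
  inner (proj f u) x = inner u x.
Proof.
move=> fo xf; rewrite inner_suml (Parseval _ fo xf).
by apply: eq_bigr => l _; rewrite innerZl.
Qed.

(** This is <v, w> = <Pv, w> for a blade w of the subspace spanned by f. *)
Lemma gram_det_proj f v w : orthonormal dot f -> {subset w <= <<f>>%VS} ->
  gram (map (proj f) v) w = gram v w.
Proof.
move=> fo wf; have [svw|svw] := eqVneq (size v) (size w); last first.
  by rewrite !gram_det_neq_size // size_map.
rewrite !(@gram_detE (size w)) ?size_map //; congr (\det _).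
apply/matrixP=> i j; rewrite !mxE (nth_map 0) ?svw // inner_proj //.
by rewrite wf // mem_nth.
Qed.

End GramDet.

(** * Distance from a blade to the blades of a subspace *)

Section Distance.
Variables (R : realType) (k : scalar_kind) (X : vectType (base_field R k)).
Variable dot : {dot X for @sconj R k}.
Notation F := (base_field R k).
Notation inner := (@inner R k X dot).
Notation gram := (@gram_det R k X dot).
Notation dist := (@sphere_dist R k X dot).
Notation OG := (oriented_Grassmannian dot).
Implicit Types (u : X) (e f v w : seq X) (V W : {vspace X}).
Local Open Scope classical_set_scope.

Lemma wedges_nil : wedges [::] = mv_scalar X 1.
Proof. by rewrite /wedges big_nil. Qed.

Lemma mv_inner_scalarr (nu : multivector X) c :
  mv_inner dot nu (mv_scalar X c) = c * mv_inner dot nu (mv_scalar X 1).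
Proof.
rewrite /mv_inner mulr_sumr; apply: eq_bigr => S _; rewrite mulr_sumr.
apply: eq_bigr => T _; rewrite !ffunE; case: ifP => _; last by rewrite !(mulr0, mul0r).
by rewrite mulr1 !mulrA; congr (_ * _); rewrite mulrC.
Qed.

Lemma mv_inner_scalarl (nu : multivector X) c :
  mv_inner dot (mv_scalar X c) nu = sconj c * mv_inner dot (mv_scalar X 1) nu.
Proof.
rewrite /mv_inner mulr_sumr; apply: eq_bigr => S _; rewrite mulr_sumr.
apply: eq_bigr => T _; rewrite !ffunE; case: ifP => _; last by rewrite !(rmorph0, mul0r, mulr0).
by rewrite rmorph1 mul1r !mulrA.
Qed.

Lemma mv_inner_scalar c d : mv_inner dot (mv_scalar X c) (mv_scalar X d) = sconj c * d.
Proof.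
rewrite mv_inner_scalarl mv_inner_scalarr -wedges_nil mv_inner_wedges.
by rewrite (@gram_detE _ _ _ _ 0) // det_mx00 mulr1.
Qed.

Lemma mv_inner_wedges_scalar v c : (0 < size v)%N ->
  mv_inner dot (wedges v) (mv_scalar X c) = 0.
Proof.
move=> sv; rewrite mv_inner_scalarr -wedges_nil mv_inner_wedges.
by rewrite gram_det_neq_size ?mulr0 // -lt0n.
Qed.

Lemma scalar_mem_Grassmannian W c : sconj c * c = 1 -> OG W (mv_scalar X c).
Proof.
move=> c1; split; last by rewrite /unit_sphere /= mv_inner_scalar.
left; exists c => //; apply: contra_eq_neq c1 => ->.
by rewrite mulr0 eq_sym oner_neq0.
Qed.

Lemma wedges_mem_Grassmannian W v : (0 < size v)%N -> {subset v <= W} -> gram v v = 1 ->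
  OG W (wedges v).
Proof.
move=> sv vW v1; split; last by rewrite /unit_sphere /= mv_inner_wedges.
by right; exists v.
Qed.

Lemma oriented_Grassmannian_cases W (om : multivector X) : OG W om ->
  (exists2 c, sconj c * c = 1 & om = mv_scalar X c) \/
  (exists v, [/\ (0 < size v)%N, {subset v <= W}, gram v v = 1 & om = wedges v]).
Proof.
case=> -[[c _ ->]|[v [sv vW ->]]]; rewrite /unit_sphere /=.
  by rewrite mv_inner_scalar => c1; left; exists c.
by rewrite mv_inner_wedges => v1; right; exists v.
Qed.

Lemma scalar_dist_min W c : sconj c * c = 1 ->
  is_minimum [set dist (mv_scalar X c) t | t in OG W] 0.
Proof.
move=> c1; split.
  exists (mv_scalar X c); first exact: scalar_mem_Grassmannian.
  by rewrite /sphere_dist mv_inner_scalar c1 -sreal1 srealK acos1.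
move=> _ [t /oriented_Grassmannian_cases [[d d1 ->]|[w [sw _ w1 ->]]] <-]; rewrite /sphere_dist.
  rewrite mv_inner_scalar acos_ge0 //.
  have := @sum_CauchySchwarz R k 'I_1 predT (fun=> c) (fun=> d).
  rewrite !big_ord1 /normsq c1 d1 -sreal1 srealK => /(_ erefl) cd1.
  by rewrite -ler_norml -sqrtr1 -sqrtr_sqr ler_wsqrtr.
have -> : sRe (mv_inner dot (mv_scalar X c) (wedges w)) = 0.
  rewrite mv_inner_scalarl -wedges_nil mv_inner_wedges gram_det_neq_size ?mulr0 ?sRe0 //.
  by rewrite eq_sym -lt0n.
by rewrite acos_ge0 // lerN10 ler01.
Qed.

(** With g = |Pv|^2 = <v, Pv>, Cauchy-Schwarz against the unit blade v gives
    g^2 <= g. *)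
Lemma proj_gram_le1 f v : orthonormal dot f -> gram v v = 1 ->
  0 <= Num.sqrt (sRe (gram (map (proj dot f) v) (map (proj dot f) v))) <= 1.
Proof.
move=> fo v1; rewrite sqrtr_ge0 /=; set g := sRe _.
have g0 : 0 <= g by exact: gram_det_ge0.
have := @gram_det_CauchySchwarz _ _ _ dot (map (proj dot f) v) v v1.
rewrite gram_detC -(gram_det_proj (f := f)) //; last exact: map_proj_mem.
rewrite sRe_conj -/g => gg; rewrite -sqrtr1 ler_wsqrtr //.
rewrite leNgt; apply/negP => g1; move: gg.
by rewrite leNgt expr2 ltr_pMr ?g1 // (lt_trans ltr01 g1).
Qed.

(** The minimum is attained at Pv / |Pv|, or at the scalar 1 if Pv = 0, and
    Cauchy-Schwarz shows that no unit blade of W is closer. *)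
Lemma blade_dist_min W f v : basis_of W f -> orthonormal dot f ->
  (0 < size v)%N -> gram v v = 1 ->
  is_minimum [set dist (wedges v) t | t in OG W]
    (acos (Num.sqrt (sRe (gram (map (proj dot f) v) (map (proj dot f) v))))).
Proof.
move=> bf fo sv v1; have /andP[r0 r1] := proj_gram_le1 fo v1.
set Pv := map _ v in r0 r1 *; set g := sRe _ in r0 r1 *.
have g0 : 0 <= g by exact: gram_det_ge0.
have gE : gram Pv Pv = sreal g by exact: gram_det_real.
have PvW : {subset Pv <= <<f>>%VS} by exact: map_proj_mem.
have sW : <<f>>%VS = W := span_basis bf.
split.
  have [gz|gnz] := eqVneq g 0.
    exists (mv_scalar X 1); first by apply: scalar_mem_Grassmannian; rewrite rmorph1 mul1r.
    by rewrite /sphere_dist mv_inner_wedges_scalar // sRe0 gz sqrtr0.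
  have rr : Num.sqrt g * Num.sqrt g = g by rewrite -expr2 sqr_sqrtr.
  have rnz : Num.sqrt g != 0 by rewrite sqrtr_eq0 -ltNge lt0r gnz.
  have [u [s defPv]] : exists u, exists s, Pv = u :: s.
    by move: sv; rewrite /Pv; case: (v) => //= a s _; exists (proj dot f a), (map (proj dot f) s).
  (* rescaling one factor of Pv is enough to normalise the blade *)
  pose a : F := sreal (Num.sqrt g)^-1; pose t := a *: u :: s.
  have tW : {subset t <= W}.
    rewrite -sW => x; rewrite inE => /predU1P[->|xs].
      by apply/memvZ/PvW; rewrite defPv mem_head.
    by apply: PvW; rewrite defPv inE xs orbT.
  have vt : gram v t = sreal (Num.sqrt g).
    rewrite gram_det_scaler -defPv -(gram_det_proj v fo PvW) -/Pv gE -srealM.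
    by rewrite -[in X in _ * X]rr mulrA mulVf // mul1r.
  exists (wedges t); last by rewrite /sphere_dist mv_inner_wedges vt srealK.
  apply: wedges_mem_Grassmannian => //.
  rewrite gram_det_scaler gram_det_scalel -defPv gE sconj_real -!srealM.
  by rewrite -[X in _ * (_ * X)]rr mulKf // mulVf // sreal1.
move=> _ [t /oriented_Grassmannian_cases [[d d1 ->]|[w [sw wW w1 ->]]] <-]; rewrite /sphere_dist.
  by rewrite mv_inner_wedges_scalar // sRe0 le_acos // lerN10.
rewrite mv_inner_wedges -(gram_det_proj v fo) -/Pv ?sW //.
have cs := gram_det_CauchySchwarz Pv w1; rewrite -/g in cs.
have : `|sRe (gram Pv w)| <= Num.sqrt g by rewrite -sqrtr_sqr ler_wsqrtr.
rewrite ler_norml => /andP[lo hi]; apply: le_acos => //.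
by apply: le_trans lo; rewrite lerN2.
Qed.

Lemma is_minimum_unique (A : set R) m m' : is_minimum A m -> is_minimum A m' -> m = m'.
Proof. by case=> Am lm [Am' lm']; apply/le_anti; rewrite lm ?lm'. Qed.

End Distance.

(** * Extremal projections of blades *)

Section Extremes.
Variables (R : realType) (k : scalar_kind) (X : vectType (base_field R k)).
Variable dot : {dot X for @sconj R k}.
Notation F := (base_field R k).
Notation inner := (@inner R k X dot).
Notation gram := (@gram_det R k X dot).
Implicit Types (u : X) (e f v w : seq X) (V W : {vspace X}).

Lemma prod_le_prod_in n (c : 'I_n -> R) (S : {set 'I_n}) :
  (forall i, 0 <= c i <= 1) -> \prod_i c i <= \prod_(i in S) c i.
Proof.
move=> c01; rewrite (bigID (mem S)) /= ler_piMr //.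
  by apply: prodr_ge0 => i _; have /andP[] := c01 i.
by apply: prodr_ile1 => i _; exact: c01.
Qed.

(** The coordinates of P v_i along f are those of v_i along e multiplied by the
    cosines c, so the minor on S is multiplied by the product of the c_l for l in
    S; as 0 <= c_l <= 1, that product is at least the product of all c_l. *)
Lemma proj_gram_ge e f v (c : seq R) : orthonormal dot e -> orthonormal dot f ->
  (size e <= size f)%N -> {subset v <= <<e>>%VS} -> gram v v = 1 ->
  (forall i, (i < size e)%N -> 0 <= c`_i <= 1) ->
  (forall i j, (i < size e)%N -> (j < size f)%N ->
        inner e`_i f`_j = if i == j then sreal c`_i else 0) ->
  (\prod_(i < size e) c`_i) ^+ 2 <=
  sRe (gram (map (proj dot f) v) (map (proj dot f) v)).
Proof.
move=> oe of_ ef ve v1 c01 eE; set Pv := map _ v; set p := size v.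
pose a := @coords R k X dot e v.
have sPv : size Pv = p by rewrite size_map.
have inner_f i j : (i < p)%N -> (j < size f)%N -> inner f`_j v`_i =
   if (j < size e)%N then inner e`_j v`_i * sreal c`_j else 0.
  move=> ip jf; have vie : v`_i \in <<e>>%VS by rewrite ve // mem_nth.
  rewrite {1}(orthonormal_coord oe vie) inner_sumr.
  have fe (l : 'I_(size e)) : inner f`_j e`_l = if l == j :> nat then sreal c`_l else 0.
    by rewrite innerC eE //; case: eqP => _; rewrite ?sconj_real ?rmorph0.
  case: ltnP => je.
    rewrite (bigD1 (Ordinal je)) //= big1 ?addr0; last first.
      by move=> l /negbTE lj; rewrite innerZr fe -[nat_of_ord l == j]/(l == Ordinal je) lj mulr0.
    by rewrite innerZr (fe (Ordinal je)) eqxx.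
  by rewrite big1 // => l _; rewrite innerZr fe ltn_eqF ?mulr0 // (leq_trans (ltn_ord l)).
have -> : gram Pv Pv = \det (\matrix_(i < p, j < p)
   \sum_(l < size e) sconj (a i l * sreal c`_l) * (a j l * sreal c`_l)).
  rewrite (gram_detE dot sPv sPv); congr (\det _); apply/matrixP=> i j; rewrite !mxE.
  rewrite !(nth_map 0) // (Parseval _ of_ (proj_mem dot f _)).
  have projr u (l : 'I_(size f)) : inner f`_l (proj dot f u) = inner f`_l u.
    by rewrite innerC (inner_proj _ of_) ?memv_span ?mem_nth // -innerC.
  rewrite (big_ord_widen _ (fun l => sconj (inner e`_l v`_i * sreal c`_l)
     * (inner e`_l v`_j * sreal c`_l)) ef) [RHS]big_mkcond /=.
  apply: eq_bigr => l _; rewrite !projr !inner_f //.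
  by case: ifP => _; rewrite ?mulr0.
rewrite (@Cauchy_Binet _ _ p (fun i l => sconj (a i l * sreal c`_l))
  (fun i l => a i l * sreal c`_l)).
have mE S : minor p (fun i (l : 'I_(size e)) => sconj (a i l * sreal c`_l)) S
    = sconj (minor p (fun i (l : 'I_(size e)) => a i l * sreal c`_l) S).
  by rewrite rmorph_minor.
rewrite (eq_bigr (fun S : {set 'I_(size e)} =>
    sconj (minor p a S * \prod_(l in S) sreal c`_l) *
    (minor p a S * \prod_(l in S) sreal c`_l))); last first.
  move=> S /eqP cS; rewrite [X in X * _]mE.
  by rewrite (minor_scale a (fun l : 'I_(size e) => sreal c`_l) cS).
(* the coordinates of the unit blade v have squared moduli adding up to 1 *)
have a1 : \sum_(S : {set 'I_(size e)} | #|S| == p) normsq (minor p a S) = 1.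
  by rewrite -(gram_det_normsq oe ve (erefl _)) v1 -sreal1 srealK.
rewrite sRe_sum -[leLHS]mulr1 -[X in _ * X <= _]a1 mulr_sumr.
apply: ler_sum => S /eqP cS; rewrite -/(normsq _) normsqM mulrC.
rewrite ler_wpM2l ?normsq_ge0 // -sreal_prod normsq_real ler_sqr ?nnegrE.
- by apply: prod_le_prod_in => i; exact: c01.
- by apply: prodr_ge0 => i _; have /andP[] := c01 i (ltn_ord i).
- by apply: prodr_ge0 => i _; have /andP[] := c01 i (ltn_ord i).
Qed.

(** As P e_i = c_i f_i, the Gram matrix is diagonal with entries c_i^2. *)
Lemma proj_gram_principal e f (c : seq R) : orthonormal dot e -> orthonormal dot f ->
  (size e <= size f)%N ->
  (forall i j, (i < size e)%N -> (j < size f)%N ->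
        inner e`_i f`_j = if i == j then sreal c`_i else 0) ->
  sRe (gram (map (proj dot f) e) (map (proj dot f) e)) = (\prod_(i < size e) c`_i) ^+ 2.
Proof.
move=> oe /[dup] of_ /orthonormalP fo ef eE.
have pe i : (i < size e)%N -> proj dot f e`_i = sreal c`_i *: f`_i.
  move=> ie; have if_ := leq_trans ie ef; rewrite /proj (bigD1 (Ordinal if_)) //=.
  rewrite innerC eE // eqxx sconj_real big1 ?addr0 // => j ji.
  rewrite innerC eE // [i == _](_ : _ = false) ?rmorph0 ?scale0r //.
  by apply: contraNF ji => /eqP ij; apply/eqP/val_inj; rewrite /= ij.
rewrite (@gram_detE _ _ _ _ (size e)) ?size_map //.
rewrite [X in \det X](_ : _ = diag_mx (\row_i sreal (c`_i ^+ 2))).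
  rewrite det_diag; under eq_bigr => i _ do rewrite mxE.
  by rewrite -sreal_prod srealK prodrXl.
apply/matrixP=> i j; rewrite !mxE !(nth_map 0) // !pe //.
rewrite innerZl innerZr sconj_real fo ?(leq_trans (ltn_ord _) ef) //.
rewrite mulrA -srealM -[nat_of_ord i == j]/(i == j).
have [<-|_] := eqVneq i j.
  by rewrite mulr1 expr2.
by rewrite mulr0.
Qed.

(** There are more vectors than coordinates, so the sum over minors is empty. *)
Lemma proj_gram_dim_gt f v : orthonormal dot f -> (size f < size v)%N ->
  gram (map (proj dot f) v) (map (proj dot f) v) = 0.
Proof.
move=> of_ fv; rewrite (gram_det_minors of_ (@map_proj_mem _ _ _ dot f v)
  (size_map _ _) (size_map _ _)) big1 // => S /eqP cS.
by have := max_card (mem S); rewrite cS card_ord leqNgt fv.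
Qed.

End Extremes.

(** * The directed Hausdorff distance *)

Section Assembly.
Local Open Scope classical_set_scope.

(** Minima are unique, so the function s |-> d(s, T) can be chosen pointwise. *)
Lemma directed_HausdorffP (R : realType) (M : Type) (d : M -> M -> R) (S T : set M) h :
  (forall s, S s -> exists2 m, is_minimum [set d s t | t in T] m & m <= h) ->
  (exists2 s, S s & is_minimum [set d s t | t in T] h) ->
  is_directed_Hausdorff d S T h.
Proof.
move=> minS [s0 Ss0 s0h].
pose delta s := xget 0 (is_minimum [set d s t | t in T]).
have deltaE s m : is_minimum [set d s t | t in T] m -> delta s = m.
  by move=> sm; apply: is_minimum_unique (xgetPex 0 (ex_intro _ m sm)) sm.
exists delta; split=> [s /minS [m sm _]|]; first by rewrite (deltaE _ _ sm).
split; first by exists s0 => //; exact: deltaE.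
by move=> _ [s /minS [m sm mh] <-]; rewrite (deltaE _ _ sm).
Qed.

Variables (R : realType) (k : scalar_kind) (X : vectType (base_field R k)).
Variable dot : {dot X for @sconj R k}.
Notation gram := (@gram_det R k X dot).
Notation OG := (oriented_Grassmannian dot).
Implicit Types (e f v : seq X) (V W : {vspace X}).

(** Unit scalars have distance 0 <= h, so only blades of positive degree matter. *)
Lemma directed_Hausdorff_blades V W f h : basis_of W f -> orthonormal dot f ->
  0 <= h ->
  (forall v, (0 < size v)%N -> {subset v <= V} -> gram v v = 1 ->
     acos (Num.sqrt (sRe (gram (map (proj dot f) v) (map (proj dot f) v)))) <= h) ->
  (exists v, [/\ (0 < size v)%N, {subset v <= V}, gram v v = 1 &
     acos (Num.sqrt (sRe (gram (map (proj dot f) v) (map (proj dot f) v)))) = h]) ->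
  is_directed_Hausdorff (sphere_dist dot) (OG V) (OG W) h.
Proof.
move=> bf of_ h0 le_h [v [sv vV v1 vh]]; apply: directed_HausdorffP.
  move=> s /oriented_Grassmannian_cases [[c c1 ->]|[w [sw wV w1 ->]]].
    by exists 0 => //; exact: scalar_dist_min.
  exact: ex_intro2 (blade_dist_min bf of_ sw w1) (le_h _ sw wV w1).
by exists (wedges v); [exact: wedges_mem_Grassmannian|rewrite -vh; exact: blade_dist_min].
Qed.

Lemma orthonormal_gram e : orthonormal dot e -> gram e e = 1.
Proof.
move=> /orthonormalP eo; rewrite (gram_detE dot (erefl _) (erefl _)).
by rewrite (_ : \matrix_(i, j) _ = 1%:M) ?det1 //; apply/matrixP=> i j; rewrite !mxE eo.
Qed.

(** A blade of positive degree with factors in the zero space vanishes, so only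
    unit scalars remain. *)
Lemma directed_Hausdorff_zero W :
  is_directed_Hausdorff (sphere_dist dot) (OG 0%VS) (OG W) 0.
Proof.
have c1 : sconj 1 * 1 = 1 :> base_field R k by rewrite rmorph1 mul1r.
apply: directed_HausdorffP; last first.
  by exists (mv_scalar X 1); [exact: scalar_mem_Grassmannian|exact: scalar_dist_min].
move=> s /oriented_Grassmannian_cases [[c cc ->]|[[|u v] [//= _ v0 v1 _]]].
  by exists 0 => //; exact: scalar_dist_min.
have /eqP u0 : u == 0 by rewrite -memv0 v0 // mem_head.
have := v1; rewrite u0 -(scale0r 0) gram_det_scaler mul0r => /eqP.
by rewrite eq_sym oner_eq0.
Qed.

Lemma directed_Hausdorff_dim_gt V W : (\dim W < \dim V)%N ->
  is_directed_Hausdorff (sphere_dist dot) (OG V) (OG W) (pi / 2).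
Proof.
move=> dWV; have [f [bf of_]] := exists_orthonormal_basis dot W.
have [e [be oe]] := exists_orthonormal_basis dot V.
have se : size e = \dim V by rewrite (size_basis (X := in_tuple e) be).
have sf : size f = \dim W by rewrite (size_basis (X := in_tuple f) bf).
apply: (directed_Hausdorff_blades bf of_); first by rewrite divr_ge0 ?pi_ge0.
  move=> v _ _ v1; have /andP[r0 r1] := proj_gram_le1 of_ v1.
  by rewrite -acos0 le_acos // lerN10.
exists e; split; rewrite ?se ?(leq_ltn_trans _ dWV) //.
- by move=> u; exact: basis_mem.
- exact: orthonormal_gram.
- by rewrite proj_gram_dim_gt ?se ?sf // sRe0 sqrtr0 acos0.
Qed.

Lemma directed_Hausdorff_dim_le V W : V != 0%VS -> (\dim V <= \dim W)%N ->
  is_directed_Hausdorff (sphere_dist dot) (OG V) (OG W)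
    (acos (\prod_(t <- principal_angles dot V W) cos t)).
Proof.
move=> V0 dVW; set th := principal_angles dot V W.
have [sth _ th_bound [e [f [[be oe] [bf of_] ef]]]] : is_principal_angles dot V W th.
  by apply: (@xgetPex _ [::]); exact: exists_principal_angles.
have se : size e = \dim V by rewrite (size_basis (X := in_tuple e) be).
have sf : size f = \dim W by rewrite (size_basis (X := in_tuple f) bf).
rewrite (minn_idPl dVW) in sth.
pose c := [seq cos t | t <- th].
have cE i : (i < size e)%N -> c`_i = cos th`_i.
  by move=> hi; rewrite (nth_map 0) // sth -se.
have c01 i : (i < size e)%N -> 0 <= c`_i <= 1.
  move=> hi; rewrite cE // cos_le1 andbT.
  have /(allP th_bound)/andP[t0 t1] : th`_i \in th by rewrite mem_nth // sth -se.
  by apply: cos_ge0_pihalf; rewrite t1 andbT (le_trans _ t0) // oppr_le0 divr_ge0 ?pi_ge0.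
have ef' i j : (i < size e)%N -> (j < size f)%N ->
    inner dot e`_i f`_j = if i == j then sreal c`_i else 0.
  by move=> hi hj; rewrite ef -?se -?sf // cE.
have prodE : \prod_(t <- th) cos t = \prod_(i < size e) c`_i.
  by rewrite -(big_map _ predT id) (big_nth 0) big_mkord size_map sth se.
rewrite prodE; set P := \prod_(i < _) _.
have P0 : 0 <= P by apply: prodr_ge0 => i _; have /andP[] := c01 i (ltn_ord i).
have P1 : P <= 1 by apply: prodr_ile1 => i _; exact: c01.
have sef : (size e <= size f)%N by rewrite se sf.
apply: (directed_Hausdorff_blades bf of_).
- by rewrite acos_ge0 // P1 (le_trans _ P0) ?lerN10.
- move=> v sv vV v1; have /andP[r0 r1] := proj_gram_le1 of_ v1.
  apply: le_acos => //; first by rewrite (le_trans _ P0) ?lerN10.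
  rewrite -[leLHS](ger0_norm P0) -sqrtr_sqr ler_wsqrtr //.
  by apply: (proj_gram_ge oe of_ sef) => // u uv; rewrite (span_basis be) vV.
- exists e; split.
  + by rewrite se lt0n dimv_eq0.
  + by move=> u; exact: basis_mem.
  + exact: orthonormal_gram.
  + by rewrite (proj_gram_principal oe of_ sef ef') sqrtr_sqr ger0_norm.
Qed.

End Assembly.

Theorem proposition4p16 (R : realType) (k : scalar_kind)
    (X : vectType (base_field R k)) (dot : {dot X for @sconj R k})
    (V W : {vspace X}) :
  is_directed_Hausdorff (sphere_dist dot)
    (oriented_Grassmannian dot V) (oriented_Grassmannian dot W)
    (Grassmann_angle dot V W).
Proof.
rewrite /Grassmann_angle; case: eqVneq => [->|V0]; first exact: directed_Hausdorff_zero.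
case: eqVneq => [->|W0].
  by apply: directed_Hausdorff_dim_gt; rewrite dimv0 lt0n dimv_eq0.
case: leqP => [dVW|dWV]; first exact: directed_Hausdorff_dim_le.
exact: directed_Hausdorff_dim_gt.
Qed.
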